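(* Assume that for every bounded interval $J\subset I$ there exist a function $\varphi=\varphi_J\in C^2(\mathbb{R}^d)$, with $\varphi(x)\to+\infty$ as $|x|\to+\infty$, and a positive constant $M_J$ such that $(\mathcal{A}(t)\varphi)(x)\le M_J$ for all $t\in J$, $x\in\mathbb{R}^d$. Then, for any $f\in C_b(\mathbb{R}^d)$, the function $(t,s,x)\mapsto(G(t,s)f)(x)$ is continuous in $\Lambda\times\mathbb{R}^d$.
   Context: $d\ge 1$ is an integer and $I\subset\mathbb{R}$ is an interval which is either $\mathbb{R}$ or a right halfline. For $t\in I$ and smooth $\varphi:\mathbb{R}^d\to\mathbb{R}$, $$(\mathcal{A}(t)\varphi)(x)=\sum_{i,j=1}^d q_{ij}(t,x)D_{ij}\varphi(x)+\sum_{i=1}^d b_i(t,x)D_i\varphi(x),$$ with $Q=(q_{ij})$, $b=(b_i)$. Assumptions on the coefficients: (1) for some $\alpha\in(0,1)$, all $q_{ij},b_i$ belong to $C^{\alpha/2,\alpha}_{\rm loc}(I\times\mathbb{R}^d)$, i.e. they are $\alpha$-Hölder continuous with respect to the parabolic distance on every compact subset of $I\times\mathbb{R}^d$; (2) for every $(t,x)\in I\times\mathbb{R}^d$ the matrix $Q(t,x)$ is symmetric, and there is a function $\eta:I\times\mathbb{R}^d\to\mathbb{R}$ with $0<\eta_0:=\inf_{I\times\mathbb{R}^d}\eta$ and $\langle Q(t,x)\xi,\xi\rangle\ge\eta(t,x)|\xi|^2$ for all $\xi\in\mathbb{R}^d$, $(t,x)\in I\times\mathbb{R}^d$. Under (1),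 (2) and the assumption in the claim, for every $s\in I$ and $f\in C_b(\mathbb{R}^d)$ (bounded continuous functions) there is a unique bounded classical solution $u_f\in C_b([s,+\infty)\times\mathbb{R}^d)\cap C^{1,2}((s,+\infty)\times\mathbb{R}^d)$ of $u_t=\mathcal{A}(t)u$ in $(s,+\infty)\times\mathbb{R}^d$, $u(s,\cdot)=f$. Set $\Lambda=\{(t,s)\in I\times I: t\ge s\}$, $G(t,t)=\mathrm{id}$, and $(G(t,s)f)(x)=u_f(t,x)$ for $t>s$; $\{G(t,s)\}$ is the associated evolution family. *)

(* Defs.v *)
From HB Require Import structures.
From mathcomp Require Import all_boot all_order all_algebra.
From mathcomp Require Import all_classical all_reals all_analysis.

Set Implicit Arguments.
Unset Strict Implicit.
Unset Printing Implicit Defensive.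

Import Order.TTheory GRing.Theory Num.Theory.
Import numFieldNormedType.Exports.

Local Open Scope classical_set_scope.
Local Open Scope ring_scope.

(* The library norm `|x| on 'rV[R]_d is the sup norm; the Euclidean one is
   needed for the ellipticity condition and the parabolic distance. *)
Definition dotp (R : realType) (d : nat) (x y : 'rV[R]_d) : R :=
  \sum_(i < d) x 0 i * y 0 i.

Definition enorm (R : realType) (d : nat) (x : 'rV[R]_d) : R :=
  Num.sqrt (dotp x x).

Definition parabolic_dist (R : realType) (d : nat) (p q : R * 'rV[R]_d) : R :=
  enorm (p.2 - q.2) + Num.sqrt `|p.1 - q.1|.

Definition holder_parabolic_loc (R : realType) (d : nat) (alpha : R)
    (D : set (R * 'rV[R]_d)) (g : R * 'rV[R]_d -> R) : Prop :=
  forall K : set (R * 'rV[R]_d), compact K -> K `<=` D ->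
    exists C : R, forall p q, K p -> K q ->
      `|g p - g q| <= C * parabolic_dist p q `^ alpha.

Definition line_or_right_halfline (R : realType) (I : set R) : Prop :=
  I = setT \/ exists a : R, I = `]a, +oo[%classic \/ I = `[a, +oo[%classic.

Section Calculus.
Variables (R : realType) (d : nat).
Implicit Types (f : 'rV[R]_d -> R) (u : R -> 'rV[R]_d -> R).

Definition pderive (i : 'I_d) f : 'rV[R]_d -> R := 'D_(delta_mx 0 i) f.

Definition pderive2 (i j : 'I_d) f : 'rV[R]_d -> R := pderive i (pderive j f).

Definition tderive u (t : R) (x : 'rV[R]_d) : R := derive1 (u ^~ x) t.

(* 'D_v f x is total: it is meaningful only where f is derivable at x along v,
   so derivability is required separately from continuity. *)
Definition twice_pderivable f : Prop :=
  forall x, (forall i, derivable f x (delta_mx 0 i)) /\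
            (forall i j, derivable (pderive j f) x (delta_mx 0 i)).

Definition C2 f : Prop :=
  [/\ twice_pderivable f, continuous f,
      forall i, continuous (pderive i f) &
      forall i j, continuous (pderive2 i j f)].

Definition C12 (T : set R) u : Prop :=
  let continuous_on_cylinder (v : R -> 'rV[R]_d -> R) :=
    {within T `*` [set: 'rV[R]_d], continuous (fun p => v p.1 p.2)} in
  [/\ forall t, T t ->
        twice_pderivable (u t) /\ (forall x, derivable (u ^~ x) t 1),
      continuous_on_cylinder u,
      continuous_on_cylinder (tderive u),
      forall i, continuous_on_cylinder (fun t => pderive i (u t)) &
      forall i j, continuous_on_cylinder (fun t => pderive2 i j (u t))].

Definition Cb f : Prop := continuous f /\ [bounded f x | x in setT].

Definition tends_to_pinfty f : Prop :=
  forall A : R, exists r : R, forall x, r <= enorm x -> A <= f x.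

End Calculus.

Section EvolutionFamily.
Variables (R : realType) (d : nat).
Variables (Q : R -> 'rV[R]_d -> 'M[R]_d) (b : R -> 'rV[R]_d -> 'rV[R]_d).

Definition generator (t : R) (phi : 'rV[R]_d -> R) (x : 'rV[R]_d) : R :=
  \sum_(i < d) \sum_(j < d) Q t x i j * pderive2 i j phi x
  + \sum_(i < d) b t x 0 i * pderive i phi x.

(* The convention inf E = 0 when E has no lower bound is harmless here: the
   strict inequality 0 < inf E excludes it. *)
Definition uniformly_elliptic (I : set R) : Prop :=
  exists eta : R -> 'rV[R]_d -> R,
    0 < inf [set eta p.1 p.2 | p in I `*` [set: 'rV[R]_d]] /\
    forall t x, I t -> forall xi : 'rV[R]_d,
      eta t x * enorm xi ^+ 2 <= dotp (xi *m (Q t x)^T) xi.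

Definition bounded_classical_solution (s : R) (f : 'rV[R]_d -> R)
    (u : R -> 'rV[R]_d -> R) : Prop :=
  [/\ {within `[s, +oo[%classic `*` [set: 'rV[R]_d], continuous (fun p => u p.1 p.2)},
      [bounded u p.1 p.2 | p in `[s, +oo[%classic `*` [set: 'rV[R]_d]],
      C12 `]s, +oo[%classic u,
      forall t x, s < t -> tderive u t x = generator t (u t) x &
      forall x, u s x = f x].

(* G t s f stands for G(t,s)f. The bounded classical solution with datum f at
   time s is unique for the coefficients considered; uniqueness is not made
   part of the definition, so it is never assumed. The clause u s = f of the
   solution gives G(s,s) = id. Values of G outside s \in I, s <= t, f \in C_b
   are irrelevant. *)
Definition evolution_family (I : set R)
    (G : R -> R -> ('rV[R]_d -> R) -> 'rV[R]_d -> R) : Prop :=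
  forall s f, I s -> Cb f ->
    bounded_classical_solution s f (fun t => G t s f).

End EvolutionFamily.

Definition Lambda (R : realType) (I : set R) : set (R * R) :=
  [set ts | [/\ I ts.1, I ts.2 & ts.2 <= ts.1]].

(* Main.v *)
Require Import Defs.
From HB Require Import structures.
From mathcomp Require Import all_boot all_order all_algebra.
From mathcomp Require Import all_classical all_reals all_analysis.
From mathcomp Require Import ring lra.

Set Implicit Arguments.
Unset Strict Implicit.
Unset Printing Implicit Defensive.

Import Order.TTheory GRing.Theory Num.Theory.
Import numFieldNormedType.Exports.

Local Open Scope classical_set_scope.
Local Open Scope ring_scope.

(** The coefficients enter only through their local boundedness and the parabolic
    maximum principle.  Comparison on a small cylinder around [x0] with the barrier
    [f x0 + eps + C |x - x0|^2 + K (t - s)] gives [G(t,s)f(x) -> f(x0)] as [t - s -> 0]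
    and [x -> x0], uniformly in [s].  For [s1 <= s2 <= t] the function
    [G(.,s1)f - G(.,s2)f] is a bounded solution on [[s2, +oo[] with datum
    [G(s2,s1)f - f], which is uniformly small on compact sets when [s2 - s1] is small;
    the supersolution [eps + c (phi + M (t - s2))] built from the Lyapunov function
    then keeps it small at later times.  Hence [G(t,s)f(x)] is continuous in [s], locally
    uniformly in [(t, x)], which together with the continuity of each
    solution gives joint continuity. *)

(** * Directional derivatives built from partial ones, and the second derivative test on a line *)

Section DirectionalDerivatives.
Variables (R : realType) (V : normedModType R).
Implicit Types (f : V -> R) (x y v e : V).

Lemma is_derive_line f y e (h l : R) :
  is_derive (y + h *: e) e f l -> is_derive h 1 (fun k => f (y + k *: e)) l.
Proof.
have E : (fun k : R => k^-1 *: (f (k *: e + (y + h *: e)) - f (y + h *: e))) =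
   (fun k : R => k^-1 *: (f (y + (k *: (1 : R) + h) *: e) - f (y + h *: e))).
  apply/funext => k; rewrite scalerDl; congr (_ *: (f _ - _)).
  by rewrite [k *: 1]mulr1 addrCA.
case=> df Df; split; first by rewrite /derivable /= -E.
by rewrite /derive /= -E.
Qed.

(** The increment [a] may have either sign, so the intermediate point is located only by
    [|th| <= |a|]. *)
Lemma mean_value_line f y e (a : R) : (forall z, derivable f z e) ->
  exists2 th : R, `|th| <= `|a| & f (y + a *: e) - f y = a * 'D_e f (y + th *: e).
Proof.
move=> df; pose p (k : R) := f (y + k *: e).
have dp (k : R) : is_derive k 1 p ('D_e f (y + k *: e)).
  exact/is_derive_line/derivableP.
have cp (i : interval R) : {within [set` i], continuous p}.
  apply: derivable_within_continuous => k _.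
  by case: (dp k).
have p0 : p 0 = f y by rewrite /p scale0r addr0.
have [a0|a0] := leP 0 a.
  have [c + E] := MVT_segment a0 (fun k _ => dp k) (cp _).
  rewrite in_itv /= => /andP[c0 ca]; exists c.
    by rewrite !ger0_norm.
  by rewrite -p0 [f _]/(p a) E subr0 mulrC.
have [c + E] := MVT_segment (ltW a0) (fun k _ => dp k) (cp _).
rewrite in_itv /= => /andP[c0 ca]; exists c.
  by rewrite !ler0_norm ?lerN2 // ltW.
by rewrite -p0 [f _]/(p a) -opprB E sub0r mulrN opprK mulrC.
Qed.

(** The increment along [v + c *: e] splits into one along [v] and one along [e] from the displaced
    point. The mean value theorem turns the second into [c] times the derivative along [e] at a
    nearby point, and continuity of that derivative at [x] gives the limit. No total
    differentiability is required. *)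
Lemma is_derive_add_direction f x v e (c l : R) :
  is_derive x v f l -> (forall z, derivable f z e) ->
  {for x, continuous ('D_e f)} ->
  is_derive x (v + c *: e) f (l + c * 'D_e f x).
Proof.
move=> dv de cD.
suff H : h^-1 *: (f (h *: (v + c *: e) + x) - f x) @[h --> (0 : R)^'] -->
    l + c * 'D_e f x.
  split; first by apply/cvg_ex; exists (l + c * 'D_e f x).
  exact: cvg_lim H.
pose q (h : R) := h^-1 *: (f (h *: v + x + (h * c) *: e) - f (h *: v + x)).
have -> : (fun h : R => h^-1 *: (f (h *: (v + c *: e) + x) - f x)) =
    (fun h : R => h^-1 *: (f (h *: v + x) - f x) + q h).
  apply/funext => h; rewrite /q -scalerDr; congr (_ *: _).
  by rewrite scalerDr scalerA addrAC; ring.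
apply: cvgD.
  by case: dv => dv <-.
apply/cvgrPdist_le => eps eps0.
(* The added 1 keeps the denominator positive when [c = 0]. *)
have eps1 : 0 < eps / (`|c| + 1) by rewrite divr_gt0 // ltr_wpDl.
move/cvgrPdist_lt : cD => /(_ _ eps1) /nbhs_ballP[r /= r0 Hr].
near=> h.
have h0 : h != 0 by near: h; exact: nbhs_dnbhs_neq.
have [th thle E] := mean_value_line (h *: v + x) (h * c) de.
rewrite /q E -mulrA [_ *: _]mulrA mulVf // mul1r -mulrBr normrM.
have : `|'D_e f x - 'D_e f (h *: v + x + th *: e)| < eps / (`|c| + 1).
  apply: Hr; rewrite -ball_normE /=.
  rewrite (addrC _ x) -addrA opprD addNKr -normrN opprK.
  apply: (@le_lt_trans _ _ (`|h| * (`|v| + `|c| * `|e|))).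
    rewrite mulrDr mulrA; apply: le_trans (ler_normD _ _) _.
    by rewrite !normrZ lerD // ler_wpM2r // -normrM.
  have B0 : 0 < `|v| + `|c| * `|e| + 1 by rewrite ltr_wpDl // addr_ge0 // mulr_ge0.
  apply: (@le_lt_trans _ _ (`|h| * (`|v| + `|c| * `|e| + 1))).
    by rewrite ler_wpM2l // lerDl.
  rewrite -ltr_pdivlMr //; near: h.
  by apply: dnbhs0_lt; rewrite divr_gt0.
move=> /ltW H; apply: (le_trans (ler_wpM2l (normr_ge0 _) H)).
by rewrite mulrA ler_pdivrMr ?ltr_wpDl // mulrC ler_pM2l // lerDl.
Unshelve. all: by end_near. Qed.

End DirectionalDerivatives.

(** If [l] were positive, [p'] would be positive just to the right of 0, and the mean value theorem
    would make [p] exceed [p 0] there. *)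
Lemma second_derivative_test (R : realType) (p p' : R -> R) (l r : R) :
  0 < r -> (forall h : R, is_derive h 1 p (p' h)) -> is_derive (0 : R) 1 p' l ->
  (forall h, `|h| < r -> p h <= p 0) -> p' 0 = 0 /\ l <= 0.
Proof.
move=> r0 dp dl pmax.
have p'0 : p' 0 = 0.
  have I0 : (0 : R) \in `](- r), r[%R by rewrite in_itv /= r0 oppr_lt0 r0.
  have : is_derive (0 : R) 1 p 0.
    apply: (@derive1_at_max _ p (- r) r) => //; first by lra.
    by move=> t; rewrite in_itv /= => /andP[a b]; apply: pmax; rewrite ltr_norml a.
  by case: (dp 0) => _ <- [_ ->].
split=> //; rewrite leNgt; apply/negP => l0.
case: dl => dl Dl.
have : h^-1 *: (p' (h *: 1 + 0) - p' 0) @[h --> (0 : R)^'] --> l.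
  by rewrite -Dl.
move=> /cvgrPdist_lt /(_ _ l0); rewrite near_withinE => /nbhs_ballP[s /= s0 Hs].
pose h := Num.min (s / 2) (r / 2).
have h0 : 0 < h by rewrite lt_min !divr_gt0.
have hs : h < s.
  by apply: (@le_lt_trans _ _ (s / 2)); [rewrite ge_min lexx|lra].
have hr : h < r.
  by apply: (@le_lt_trans _ _ (r / 2)); [rewrite ge_min lexx orbT|lra].
have cp : {within `[0, h], continuous p}.
  apply: derivable_within_continuous => k _.
  by case: (dp k).
have [c + E] := MVT h0 (fun k _ => dp k) cp.
rewrite in_itv /= => /andP[c0 ch].
have : ball 0 s c.
  by rewrite -ball_normE /= sub0r normrN gtr0_norm // (lt_trans ch).
move=> /Hs; rewrite gt_eqF // => /(_ isT).
rewrite p'0 subr0 addr0 [c *: 1]mulr1 => /ltr_distlDr.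
rewrite [_ *: _]mulrC ltrDr pmulr_lgt0 ?invr_gt0 // => p'c.
have := pmax h; rewrite gtr0_norm // hr => /(_ isT).
by rewrite -subr_le0 E subr0 leNgt mulr_gt0.
Qed.

(** * Contraction of a positive semidefinite matrix with a negative semidefinite form *)

Section PositiveSemidefinite.
Variables (R : realType) (n : nat).
Implicit Types (M H : 'M[R]_n) (x y : 'rV[R]_n).

Let bilin M x y : R := (x *m M *m y^T) 0 0.

Definition psd M := M^T = M /\ forall x, 0 <= (x *m M *m x^T) 0 0.

Let bilinC M x y : M^T = M -> bilin M x y = bilin M y x.
Proof.
move=> sM; rewrite /bilin.
have <- : (x *m M *m y^T)^T = y *m M *m x^T by rewrite !trmx_mul trmxK sM mulmxA.
by rewrite [RHS]mxE.
Qed.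

Let bilin_shift M x y (t : R) : M^T = M ->
  bilin M (x + t *: y) (x + t *: y) =
  bilin M x x + t * bilin M y x *+ 2 + t ^+ 2 * bilin M y y.
Proof.
move=> sM; rewrite /bilin linearD linearZ /= !mulmxDl !mulmxDr.
have C := bilinC x y sM; rewrite /bilin in C.
rewrite -!scalemxAl -!scalemxAr; move: C.
move: (x *m _ *m _) (x *m _ *m _) (y *m _ *m _) (y *m _ *m _) => a b c e E.
by rewrite !mxE E; ring.
Qed.

Let bilin_delta M k x : bilin M (delta_mx 0 k) x = (row k M *m x^T) 0 0.
Proof. by rewrite /bilin -rowE. Qed.

Let bilin_delta2 M k j : bilin M (delta_mx 0 k) (delta_mx 0 j) = M k j.
Proof. by rewrite bilin_delta trmx_delta -colE !mxE. Qed.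

Lemma psd_diag_ge0 M k : psd M -> 0 <= M k k.
Proof. by case=> _ /(_ (delta_mx 0 k)); rewrite -/(bilin _ _ _) bilin_delta2. Qed.

(** With [M k k = 0] the form is affine in [t] on the line [e_j + t e_k]; a nonzero slope would give
    it negative values. *)
Lemma psd_diag_eq0 M k j : psd M -> M k k = 0 -> M k j = 0.
Proof.
move=> [sM pM] Mk0; apply/eqP/negPn/negP => Mkj.
(* This [t] makes the value of the form equal to -1. *)
pose t := - (M j j + 1) / (M k j *+ 2).
have := pM (delta_mx 0 j + t *: delta_mx 0 k).
rewrite -/(bilin _ _ _) bilin_shift // !bilin_delta2 Mk0 mulr0 addr0 /t.
have -> : - (M j j + 1) / (M k j *+ 2) * M k j *+ 2 = - (M j j + 1) by field.
by lra.
Qed.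

(** The Schur complement of the pivot [M k k], kept at size [n] with row and column [k] zero when
    the pivot is nonzero, so that the induction below never changes dimension. *)
Definition schur M k : 'M[R]_n := M - (M k k)^-1 *: ((row k M)^T *m row k M).

Lemma schurE M k i j : schur M k i j = M i j - (M k k)^-1 * (M k i * M k j).
Proof. by rewrite !mxE big_ord1 !mxE. Qed.

(** The form of the complement at [x] is the form of [M] at [x] shifted along [e_k] so as to
    complete the square. *)
Lemma psd_schur M k : psd M -> M k k != 0 -> psd (schur M k).
Proof.
move=> [sM pM] Mk; split.
  by apply/matrixP => i j; rewrite mxE !schurE -{1}sM mxE [M k j * _]mulrC.
move=> x.
have -> : (x *m schur M k *m x^T) 0 0 =
    bilin M x x - (M k k)^-1 * bilin M (delta_mx 0 k) x ^+ 2.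
  rewrite bilin_delta /bilin /schur mulmxBr mulmxBl -scalemxAr -scalemxAl.
  have -> : x *m ((row k M)^T *m row k M) *m x^T =
      (row k M *m x^T)^T *m (row k M *m x^T).
    by rewrite trmx_mul trmxK !mulmxA.
  move: (x *m _ *m _) (row k M *m _) => a c.
  by rewrite !mxE big_ord1 !mxE expr2.
have := pM (x - (bilin M (delta_mx 0 k) x / M k k) *: delta_mx 0 k).
rewrite -scaleNr -/(bilin _ _ _) bilin_shift // bilin_delta2.
congr (0 <= _); move: (bilin _ _ _) (bilin _ _ _) (M k k) Mk => a c e e0.
by field.
Qed.

(** Lagrange reduction replaces diagonalization: [M] is its Schur complement plus a positive
    multiple of the rank-one matrix of row [k]. The rank-one part contributes a positive multiple of
    a value of the form of [H], and the induction runs on the number of nonzero diagonal entries. *)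
Lemma psd_contraction_le0 M H : psd M ->
  (forall x, \sum_(i < n) \sum_(j < n) x 0 i * x 0 j * H i j <= 0) ->
  \sum_(i < n) \sum_(j < n) M i j * H i j <= 0.
Proof.
move=> + Hn; have [m] := ubnP #|[pred i | M i i != 0]|.
elim: m M => // m IH M mM pM.
have [k Mk|M0] := pickP [pred i | M i i != 0]; last first.
  rewrite big1 // => i _; rewrite big1 // => j _.
  by rewrite psd_diag_eq0 ?mul0r //; apply/eqP; have /negbFE := M0 i.
move: Mk => /= Mk; have pS := psd_schur pM Mk.
have Mk0 : 0 < M k k by rewrite lt_def Mk psd_diag_ge0.
have -> : \sum_(i < n) \sum_(j < n) M i j * H i j =
   \sum_(i < n) \sum_(j < n) schur M k i j * H i j +
   (M k k)^-1 * \sum_(i < n) \sum_(j < n) row k M 0 i * row k M 0 j * H i j.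
  rewrite mulr_sumr -big_split /=; apply: eq_bigr => i _.
  rewrite mulr_sumr -big_split /=; apply: eq_bigr => j _.
  by rewrite schurE !mxE; ring.
rewrite -[leRHS]addr0 lerD //; last by rewrite mulr_ge0_le0 // invr_ge0 ltW.
apply: IH => //; rewrite -ltnS; apply: leq_trans mM; rewrite ltnS.
(* The elimination clears the diagonal entry [k], and an already zero diagonal entry stays zero
   because its whole row vanishes. *)
apply/proper_card/properP; split; last first.
  exists k; rewrite !inE // schurE mulrA mulVf ?mul1r ?subrr ?eqxx //.
apply/fintype.subsetP => i; rewrite !inE; apply: contraNneq => Mi.
rewrite schurE Mi.
have -> : M k i = 0 by rewrite -(proj1 pM) mxE (psd_diag_eq0 _ pM).
by rewrite mul0r mulr0 subr0.
Qed.

End PositiveSemidefinite.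

(** * Calculus of C2 functions, their local maxima, and the squared Euclidean distance *)

Section TwiceDifferentiable.
Variables (R : realType) (d : nat).
Implicit Types (f g : 'rV[R]_d -> R) (x y : 'rV[R]_d).

Let pderive_lin f g (c : R) i x :
  derivable f x (delta_mx 0 i) -> derivable g x (delta_mx 0 i) ->
  is_derive x (delta_mx 0 i : 'rV[R]_d) (fun y => f y + c * g y)
    (pderive i f x + c * pderive i g x).
Proof. by move=> /derivableP df /derivableP dg; exact: is_deriveD. Qed.

Lemma pderive_linear f g (c : R) i : twice_pderivable f -> twice_pderivable g ->
  pderive i (fun y => f y + c * g y) = fun y => pderive i f y + c * pderive i g y.
Proof.
move=> df dg; apply/funext => x; apply: derive_val.
by apply: pderive_lin; [case: (df x) | case: (dg x)].
Qed.

Lemma pderive2_linear f g (c : R) i j : twice_pderivable f -> twice_pderivable g ->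
  pderive2 i j (fun y => f y + c * g y) =
  fun y => pderive2 i j f y + c * pderive2 i j g y.
Proof.
move=> df dg; rewrite /pderive2 pderive_linear //.
apply/funext => x; apply: derive_val.
by apply: pderive_lin; [case: (df x) | case: (dg x)].
Qed.

Lemma C2_linear f g (c : R) : C2 f -> C2 g -> C2 (fun y => f y + c * g y).
Proof.
move=> [df cf cf1 cf2] [dg cg cg1 cg2].
have cD (u v : 'rV[R]_d -> R) : continuous u -> continuous v ->
    continuous (fun y => u y + c * v y).
  move=> cu cv x; apply: (@continuousD _ _ _ u (fun y => c * v y)); first exact: cu.
  by apply: (@continuousM _ _ (cst c) v); [exact: cst_continuous|exact: cv].
split.
- move=> x; split=> [i|i j]; last rewrite pderive_linear //; apply: ex_derive;
    by apply: pderive_lin; [case: (df x)|case: (dg x)].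
- exact: cD.
- by move=> i; rewrite pderive_linear //; exact: cD.
- by move=> i j; rewrite pderive2_linear //; exact: cD.
Qed.

Lemma pderive_cst (a : R) i : pderive i (fun _ : 'rV[R]_d => a) = fun=> 0.
Proof. by apply/funext => x; rewrite /pderive [LHS](@derive_cst _ _ _ a). Qed.

Lemma C2_cst (a : R) : C2 (fun _ : 'rV[R]_d => a).
Proof.
have c0 (c : R) : continuous (fun _ : 'rV[R]_d => c).
  by move=> x; exact: cst_continuous.
split=> //.
- by move=> x; split=> [i|i j]; rewrite ?pderive_cst.
- by move=> i; rewrite pderive_cst.
- by move=> i j; rewrite /pderive2 pderive_cst pderive_cst.
Qed.

(** Coordinate directions are added one at a time, each step using continuity of one partial
    derivative. *)
Lemma is_derive_direction f x xi :
  (forall z i, derivable f z (delta_mx 0 i)) ->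
  (forall i, continuous (pderive i f)) ->
  is_derive x xi f (\sum_(i < d) xi 0 i * pderive i f x).
Proof.
move=> df cf; rewrite [X in is_derive x X f](row_sum_delta xi).
elim: (index_enum _) => [|i s IH]; first by rewrite !big_nil; exact: is_derive0.
rewrite !big_cons addrC [X in is_derive _ _ _ X]addrC.
by apply: is_derive_add_direction => //; exact: cf.
Qed.

(** Along each line [x + h *: xi] the function has a local maximum at [h = 0], so the one-variable
    test applies. Coordinate directions give the gradient, arbitrary ones the Hessian form. *)
Lemma C2_local_max g x (r : R) : C2 g -> 0 < r ->
  (forall y, `|y - x| < r -> g y <= g x) ->
  (forall i, pderive i g x = 0) /\
  forall xi : 'rV[R]_d,
    \sum_(i < d) \sum_(j < d) xi 0 i * xi 0 j * pderive2 i j g x <= 0.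
Proof.
move=> [dg cg cg1 cg2] r0 gmax.
pose D (xi : 'rV[R]_d) (y : 'rV[R]_d) : R := \sum_(j < d) xi 0 j * pderive j g y.
have test xi : D xi x = 0 /\
    \sum_(i < d) \sum_(j < d) xi 0 i * xi 0 j * pderive2 i j g x <= 0.
  have [s s0 smax] : exists2 s, 0 < s &
      forall h : R, `|h| < s -> g (x + h *: xi) <= g (x + 0 *: xi).
    exists (r / (`|xi| + 1)) => [|h]; first by rewrite divr_gt0 // ltr_wpDl.
    rewrite ltr_pdivlMr ?ltr_wpDl // => hr; rewrite scale0r addr0 gmax //.
    rewrite addrAC subrr add0r normrZ (le_lt_trans _ hr) //.
    by rewrite ler_wpM2l // lerDl.
  have := @second_derivative_test R (fun h => g (x + h *: xi))
    (fun h => D xi (x + h *: xi)) _ s s0 _ _ smax.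
  rewrite scale0r addr0; apply.
    move=> h; apply/is_derive_line/is_derive_direction => //.
    by move=> z i; case: (dg z).
  apply: is_derive_line; rewrite scale0r addr0.
  pose L j := \sum_(i < d) xi 0 i * pderive2 i j g x.
  have dL j : is_derive x xi (pderive j g) (L j).
    by apply: is_derive_direction => [z i|i]; [case: (dg z)|exact: cg2].
  have -> : \sum_(i < d) \sum_(j < d) xi 0 i * xi 0 j * pderive2 i j g x =
      \sum_(j < d) xi 0 j * L j.
    rewrite exchange_big /=; apply: eq_bigr => j _; rewrite mulr_sumr.
    by apply: eq_bigr => i _; ring.
  rewrite /D; elim: (index_enum _) => [|j t IH].
    by under eq_fun do rewrite big_nil; rewrite big_nil; exact: is_derive_cst.
  under eq_fun do rewrite big_cons; rewrite big_cons.
  apply: is_deriveD => //; exact: (@is_deriveZ _ _ _ (pderive j g)).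
split=> [i|xi]; last by case: (test xi).
have [<- _] := test (delta_mx 0 i).
rewrite /D (bigD1 i) //= big1 => [|j ji]; first by rewrite !mxE !eqxx mul1r addr0.
by rewrite !mxE eqxx (negbTE ji) mul0r.
Qed.

Lemma is_derive_coord (x0 y v : 'rV[R]_d) k :
  is_derive y v (fun z : 'rV[R]_d => (z - x0) 0 k) (v 0 k).
Proof.
suff H : h^-1 *: ((h *: v + y - x0) 0 k - (y - x0) 0 k) @[h --> (0 : R)^'] --> v 0 k.
  split; first by apply/cvg_ex; exists (v 0 k).
  exact: cvg_lim H.
apply: cvg_near_cst; near=> h.
have h0 : h != 0 by near: h; exact: nbhs_dnbhs_neq.
by rewrite !mxE -addrA addrK [_ *: _]mulrA mulVf ?mul1r.
Unshelve. all: by end_near. Qed.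

Let is_derive_sqdist (x0 y : 'rV[R]_d) i :
  is_derive y (delta_mx 0 i : 'rV[R]_d) (fun y => dotp (y - x0) (y - x0))
    (2 * (y - x0) 0 i).
Proof.
rewrite /dotp; have -> : 2 * (y - x0) 0 i =
    \sum_(k < d) (delta_mx 0 i : 'rV[R]_d) 0 k * (2 * (y - x0) 0 k).
  rewrite (bigD1 i) //= big1 => [|j ji]; first by rewrite !mxE !eqxx mul1r addr0.
  by rewrite mxE eqxx (negbTE ji) mul0r.
elim: (index_enum _) => [|k t IH].
  by under eq_fun do rewrite big_nil; rewrite big_nil; exact: is_derive_cst.
under eq_fun do rewrite big_cons; rewrite big_cons.
apply: is_deriveD => //.
have D := is_derive_coord x0 y (delta_mx 0 i) k.
apply: is_derive_eq (is_deriveM D D) _.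
by rewrite /GRing.scale /=; ring.
Qed.

Lemma pderive_sqdist (x0 : 'rV[R]_d) i :
  pderive i (fun y => dotp (y - x0) (y - x0)) = fun y => 2 * (y - x0) 0 i.
Proof. by apply/funext => y; case: (is_derive_sqdist x0 y i). Qed.

Let is_derive2_sqdist (x0 y : 'rV[R]_d) i j :
  is_derive y (delta_mx 0 i : 'rV[R]_d)
    (pderive j (fun y => dotp (y - x0) (y - x0))) (2 * (j == i)%:R).
Proof.
rewrite pderive_sqdist.
apply: is_derive_eq (is_deriveZ 2 (is_derive_coord x0 y (delta_mx 0 i) j)) _.
by rewrite mxE eqxx.
Qed.

Lemma pderive2_sqdist (x0 : 'rV[R]_d) i j :
  pderive2 i j (fun y => dotp (y - x0) (y - x0)) = fun=> 2 * (j == i)%:R.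
Proof. by apply/funext => y; case: (is_derive2_sqdist x0 y i j). Qed.

Lemma C2_sqdist (x0 : 'rV[R]_d) : C2 (fun y => dotp (y - x0) (y - x0)).
Proof.
have cx k : continuous (fun y : 'rV[R]_d => (y - x0) 0 k).
  move=> y; apply: (@continuous_comp _ _ _ (fun z : 'rV[R]_d => z - x0)
    (fun z : 'rV[R]_d => z 0 k)).
    by apply: (@continuousB _ _ _ id); [exact: cvg_id|exact: cst_continuous].
  exact: coord_continuous.
split.
- move=> x; split=> [i|i j].
    by case: (is_derive_sqdist x0 x i).
  by case: (is_derive2_sqdist x0 x i j).
- rewrite /dotp; elim: (index_enum _) => [|k t IH] x.
    by under eq_fun do rewrite big_nil; exact: cst_continuous.
  under eq_fun do rewrite big_cons.
  pose ck := fun y : 'rV[R]_d => (y - x0) 0 k.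
  apply: (@continuousD _ _ _ (fun y => ck y * ck y)); last exact: IH.
  by apply: (@continuousM _ _ ck ck); exact: cx.
- move=> i x; rewrite pderive_sqdist.
  by apply: (@continuousM _ _ (cst 2)); [exact: cst_continuous|exact: cx].
- by move=> i j x; rewrite pderive2_sqdist; exact: cst_continuous.
Qed.

End TwiceDifferentiable.

(** Only earlier times are compared, since the maximum over a closed time interval may sit at its
    final time. *)
Lemma left_max_derive_ge0 (R : realType) (p : R -> R) (s t l : R) : s < t ->
  is_derive t 1 p l -> (forall tau, s < tau < t -> p tau <= p t) -> 0 <= l.
Proof.
move=> st [dp Dp] pmax; rewrite leNgt; apply/negP => l0.
have : h^-1 *: (p (h *: 1 + t) - p t) @[h --> (0 : R)^'] --> l by rewrite -Dp.
have l1 : 0 < - l by rewrite oppr_gt0.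
move=> /cvgrPdist_lt /(_ _ l1); rewrite near_withinE => /nbhs_ballP[e /= e0 He].
pose h := Num.min (e / 2) ((t - s) / 2).
have h0 : 0 < h by rewrite lt_min !divr_gt0 // subr_gt0.
have he : h < e by apply: (@le_lt_trans _ _ (e / 2)); [rewrite ge_min lexx|lra].
have ht : h < t - s.
  by apply: (@le_lt_trans _ _ ((t - s) / 2)); [rewrite ge_min lexx orbT|lra].
have : ball 0 e (- h) by rewrite -ball_normE /= sub0r opprK gtr0_norm.
move=> /He; rewrite oppr_eq0 gt_eqF // => /(_ isT).
rewrite [- h *: 1]mulr1 ltr_norml => /andP[+ _].
rewrite opprK ltrDl oppr_gt0 [_ *: _]mulrC.
rewrite nmulr_llt0 ?invr_lt0 ?oppr_lt0 // subr_gt0 ltNge pmax //.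
by apply/andP; split; lra.
Qed.

(** * Time slices and compact balls *)

Lemma within_continuousB (R : realType) (T : topologicalType) (A : set T)
    (f g : T -> R) : {within A, continuous f} -> {within A, continuous g} ->
  {within A, continuous (fun x => f x - g x)}.
Proof.
by move=> cf cg x; apply: (@continuousB _ _ (subspace A) f g); [exact: cf|exact: cg].
Qed.

Lemma continuous_slice (R : realType) (d : nat) (T : set R)
    (v : R -> 'rV[R]_d -> R) (t : R) :
  {within T `*` [set: 'rV[R]_d], continuous (fun p => v p.1 p.2)} -> T t ->
  continuous (v t).
Proof.
move=> /subspace_continuousP cv Tt x.
have cp : (t, y) @[y --> x] --> within (T `*` [set: 'rV[R]_d]) (nbhs (t, x)).
  move=> A /nbhs_ballP[e /= e0 He]; apply/nbhs_ballP; exists e => // y xy.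
  by apply: He => //; split=> //=; exact: ballxx.
have := cv (t, x); rewrite /= => /(_ (conj Tt I)) c.
by move=> A /c /cp.
Qed.

Lemma C12_slice (R : realType) (d : nat) (T : set R) (u : R -> 'rV[R]_d -> R) t :
  C12 T u -> T t -> C2 (u t).
Proof.
move=> [du cu _ cu1 cu2] Tt; have [d2 _] := du _ Tt; split => //.
- exact: (@continuous_slice _ _ T u).
- by move=> i; exact: (@continuous_slice _ _ T (fun t => pderive i (u t))).
- by move=> i j; exact: (@continuous_slice _ _ T (fun t => pderive2 i j (u t))).
Qed.

Lemma compact_norm_ball (R : realType) (d : nat) (x0 : 'rV[R]_d) (r : R) :
  compact [set x | `|x - x0| <= r].
Proof.
apply: bounded_closed_compact.
  exists (`|x0| + r); split; first exact: num_real.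
  move=> M rM x /= xr; apply: le_trans (ltW rM).
  by rewrite -[x](subrK x0) addrC (le_trans (ler_normD _ _)) // lerD.
have -> : [set x | `|x - x0| <= r] = closed_ball_ Num.norm x0 r.
  by apply/seteqP; split => x /=; rewrite distrC.
exact: closed_closed_ball_.
Qed.

(** * The parabolic maximum principle on bounded cylinders *)

Section ParabolicComparison.
Variables (R : realType) (d : nat).
Variables (Q : R -> 'rV[R]_d -> 'M[R]_d) (b : R -> 'rV[R]_d -> 'rV[R]_d).
Implicit Types (u v : R -> 'rV[R]_d -> R) (phi f g : 'rV[R]_d -> R).

Lemma generator_linear t f g (c : R) x : twice_pderivable f -> twice_pderivable g ->
  generator Q b t (fun y => f y + c * g y) x =
  generator Q b t f x + c * generator Q b t g x.
Proof.
move=> df dg; rewrite /generator mulrDr addrACA; congr (_ + _).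
  rewrite mulr_sumr -big_split /=; apply: eq_bigr => i _.
  rewrite mulr_sumr -big_split /=; apply: eq_bigr => j _.
  rewrite pderive2_linear //.
  by move: (Q t x i j) (pderive2 i j f x) (pderive2 i j g x) => q p1 p2; ring.
rewrite mulr_sumr -big_split /=; apply: eq_bigr => i _.
rewrite pderive_linear //.
by move: (b t x 0 i) (pderive i f x) (pderive i g x) => q p1 p2; ring.
Qed.

Lemma generator_cst t (a : R) x : generator Q b t (fun=> a) x = 0.
Proof.
rewrite /generator /pderive2; rewrite !big1 ?addr0 // => i _.
  by rewrite pderive_cst mulr0.
by rewrite big1 // => j _; rewrite pderive_cst pderive_cst mulr0.
Qed.

(** The drift term vanishes with the gradient; the second-order term contracts [Q t x] with a
    negative semidefinite Hessian. *)
Lemma generator_local_max_le0 t g x (r : R) : psd (Q t x) -> C2 g -> 0 < r ->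
  (forall y, `|y - x| < r -> g y <= g x) -> generator Q b t g x <= 0.
Proof.
move=> pQ cg r0 gmax; have [g1 g2] := C2_local_max cg r0 gmax.
rewrite /generator [X in _ + X]big1 ?addr0 => [|i _]; last by rewrite g1 mulr0.
have := @psd_contraction_le0 _ _ (Q t x) (\matrix_(i, j) pderive2 i j g x) pQ.
under eq_bigr do under eq_bigr do rewrite mxE.
apply => xi; under eq_bigr do under eq_bigr do rewrite mxE.
exact: g2.
Qed.

(** Initial datum and boundedness are left out, so that the notion is stable under differences and
    under a later starting time. *)
Definition solves (s : R) u :=
  [/\ {within `[s, +oo[%classic `*` [set: 'rV[R]_d], continuous (fun p => u p.1 p.2)},
      forall t, s < t -> C2 (u t) &
      forall t x, s < t -> is_derive t 1 (u ^~ x) (generator Q b t (u t) x)].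

Lemma bounded_classical_solution_solves s f u :
  bounded_classical_solution Q b s f u -> solves s u.
Proof.
case=> cu _ Cu eu _; split=> // [t st|t x st].
  by apply: C12_slice Cu _; rewrite /= in_itv /= st.
have [/(_ t)[|_ /(_ x) du]] := Cu; first by rewrite /= in_itv /= st.
by move=> _ _ _ _; rewrite -eu // /tderive derive1E; exact: derivableP.
Qed.

Lemma solves_restrict s s' u : s <= s' -> solves s u -> solves s' u.
Proof.
move=> ss' [cu Cu eu]; split.
- apply: continuous_subspaceW cu => -[t x] /=; rewrite !in_itv /= !andbT => -[st _].
  by split=> //; exact: le_trans st.
- by move=> t st; apply: Cu; exact: le_lt_trans st.
- by move=> t x st; apply: eu; exact: le_lt_trans st.
Qed.

Lemma solves0 s : solves s (fun _ _ => 0).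
Proof.
split=> [|t _|t x _]; first exact/continuous_subspaceT/cst_continuous.
  exact: C2_cst.
by rewrite generator_cst; exact: is_derive_cst.
Qed.

Lemma solves_sub s u v : solves s u -> solves s v ->
  solves s (fun t x => u t x - v t x).
Proof.
move=> [cu Cu eu] [cv Cv ev].
have E t : (fun x => u t x - v t x) = (fun x => u t x + (-1) * v t x).
  by apply/funext => x; rewrite mulN1r.
split.
- exact: within_continuousB.
- by move=> t st; rewrite E; apply: C2_linear; [exact: Cu|exact: Cv].
- move=> t x st; rewrite E.
  have [du _ _ _] := Cu t st; have [dv _ _ _] := Cv t st.
  rewrite generator_linear // mulN1r.
  by apply: is_deriveB; [exact: eu|exact: ev].
Qed.

(* A positive maximum of [u - w] cannot occur at an interior point: there the time
   derivative is nonnegative and the generator nonpositive. Raising the slope [k]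
   by [e] makes the supersolution inequality strict. *)
Lemma comparison_on_cylinder (s T : R) x0 (r a k c : R) phi u :
  (forall t x, s < t <= T -> psd (Q t x)) -> solves s u -> C2 phi ->
  (forall x, `|x - x0| <= r -> u s x <= a + c * phi x) ->
  (forall t x, s < t <= T -> `|x - x0| = r ->
    u t x <= a + k * (t - s) + c * phi x) ->
  (forall t x, s < t <= T -> `|x - x0| < r -> c * generator Q b t phi x <= k) ->
  forall t x, s <= t <= T -> `|x - x0| <= r ->
    u t x <= a + k * (t - s) + c * phi x.
Proof.
move=> pQ [cu Cu eu] Cphi uinit ulat kphi t x /andP[st tT] xr.
suff H e : 0 < e -> u t x - (a + (k + e) * (t - s) + c * phi x) <= 0.
  apply/ler_addgt0Pr => e e0.
  (* Raising the slope by [e / (T - s + 1)] costs at most [e] over the whole time interval. *)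
  have B : e / (T - s + 1) * (t - s) <= e.
    rewrite mulrAC ler_pdivrMr; first by rewrite ler_pM2l //; lra.
    by rewrite ltr_wpDl // subr_ge0 (le_trans st).
  have : 0 < e / (T - s + 1).
    by rewrite divr_gt0 // ltr_wpDl // subr_ge0 (le_trans st).
  by move=> /H; lra.
move=> e0.
pose w (p : R * 'rV[R]_d) := a + (k + e) * (p.1 - s) + c * phi p.2.
pose A := `[s, T]%classic `*` [set y | `|y - x0| <= r].
have cA : compact A.
  by apply: compact_setX; [exact: segment_compact|exact: compact_norm_ball].
have cphi : continuous (fun p : R * 'rV[R]_d => phi p.2).
  move=> p; apply: (@continuous_comp _ _ _ snd phi); first exact: cvg_snd.
  by case: Cphi => _ + _ _; apply.
have cw : continuous w.
  move=> p; pose w1 (p : R * 'rV[R]_d) : R := a + (k + e) * (p.1 - s).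
  apply: (@continuousD _ _ _ w1 (fun p => c * phi p.2)); last first.
    by apply: (@continuousM _ _ (cst c)); [exact: cst_continuous|exact: cphi].
  apply: (@continuousD _ _ _ (cst a) (fun p => (k + e) * (p.1 - s))).
    exact: cst_continuous.
  apply: (@continuousM _ _ (cst (k + e)) (fun p => p.1 - s)).
    exact: cst_continuous.
  apply: (@continuousB _ _ _ fst (cst s)); last exact: cst_continuous.
  exact: cvg_fst.
have cuw : {within A, continuous (fun p => u p.1 p.2 - w p)}.
  apply: within_continuousB; last exact: (continuous_subspaceT cw).
  apply: continuous_subspaceW cu => -[t1 x1] /=.
  by rewrite !in_itv /= andbT => -[/andP[? _] _].
have Atx : A (t, x) by split=> //=; rewrite in_itv /= st.
(* The maximum of [u - w] lies at the initial time, on the lateral boundary or elsewhere. The first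
   two cases give the bound from the hypotheses; the third is contradictory. *)
have [[t1 x1] + max] := compact_EVT_max (ex_intro _ _ Atx) cA cuw.
rewrite inE => -[/=]; rewrite in_itv /= => /andP[st1 t1T] x1r.
have /max := mem_set Atx; rewrite /w /= => le1.
apply: le_trans le1 _.
have [t1s|t1s] := eqVneq t1 s.
  by have := uinit _ x1r; rewrite t1s; lra.
have {t1s}st1' : s < t1 by rewrite lt_def t1s.
have I1 : s < t1 <= T by rewrite st1'.
have e1 : 0 <= e * (t1 - s) by rewrite mulr_ge0 ?ltW // subr_gt0.
have [x1r'|x1r'] := eqVneq `|x1 - x0| r.
  by have := ulat _ _ I1 x1r'; lra.
have {x1r'}x1r' : `|x1 - x0| < r by rewrite lt_def eq_sym x1r'.
exfalso.
(* At the fixed time [t1], [u - w] differs from [u - c phi] by a constant, so both have the same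
   spatial maximum. *)
have g0 : generator Q b t1 (fun y => u t1 y + (- c) * phi y) x1 <= 0.
  apply: (@generator_local_max_le0 _ _ _ (r - `|x1 - x0|)).
  - exact: pQ.
  - exact: (C2_linear (- c) (Cu _ st1') Cphi).
  - by rewrite subr_gt0.
  - move=> y yr; have Ay : A (t1, y).
      split=> /=; first by rewrite in_itv /= st1.
      rewrite -[y](subrK x1) -addrA (le_trans (ler_normD _ _)) //.
      by rewrite -lerBrDr ltW.
    have /max := mem_set Ay; rewrite /w /=.
    move: (u t1 y) (u t1 x1) (phi y) (phi x1) ((k + e) * _) => U1 U2 P1 P2 K.
    by clear; lra.
move: g0; rewrite generator_linear; last by case: Cphi.
  have k1 := kphi _ _ I1 x1r'.
  have : 0 <= generator Q b t1 (u t1) x1 - (k + e).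
    apply: (@left_max_derive_ge0 _ (fun tau => u tau x1 - (k + e) * tau) s t1) => //.
      apply: is_deriveB; first exact: eu.
      apply: is_derive_eq (is_deriveZ (k + e) (is_derive_id t1 1)) _.
      by rewrite /GRing.scale /= mulr1.
    move=> tau /andP[stau taut].
    have At : A (tau, x1).
      by split=> //=; rewrite in_itv /= (ltW stau) (le_trans (ltW taut)).
    have /max := mem_set At; rewrite /w /=.
    by move: (u tau x1) (u t1 x1) (phi x1) => U1 U2 P; clear; lra.
  move: k1 e0; move: (generator _ _ _ _ _) (generator _ _ _ _ _) => g1 g2.
  by clear; lra.
by case: (Cu _ st1').
Qed.

End ParabolicComparison.

(** * Comparison of the sup norm with the Euclidean norm *)

Section EuclideanNorm.
Variables (R : realType) (d : nat).
Implicit Types y : 'rV[R]_d.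

Lemma norm_le_enorm y : `|y| <= enorm y.
Proof.
rewrite [`|y|]mx_normrE; apply/bigmax_leP; split=> [|[i j] _ /=].
  exact: sqrtr_ge0.
rewrite -sqrtr_sqr ler_wsqrtr // /dotp (bigD1 j) //= ord1 expr2 lerDl.
by apply: sumr_ge0 => k _; rewrite -expr2 sqr_ge0.
Qed.

Lemma dotp_ge0 y : 0 <= dotp y y.
Proof. by apply: sumr_ge0 => k _; rewrite -expr2 sqr_ge0. Qed.

Lemma sqr_norm_le_dotp y : `|y| ^+ 2 <= dotp y y.
Proof.
rewrite -[leRHS](sqr_sqrtr (dotp_ge0 y)) lerXn2r ?nnegrE ?sqrtr_ge0 //.
exact: norm_le_enorm.
Qed.

Lemma coord_le_norm y i : `|y 0 i| <= `|y|.
Proof.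
rewrite [leRHS]mx_normrE.
exact: (le_bigmax _ (fun p : 'I_1 * 'I_d => `|y p.1 p.2|) (0, i)).
Qed.

Lemma enorm_le_norm y (r : R) : `|y| <= r -> enorm y <= Num.sqrt (d%:R * r ^+ 2).
Proof.
move=> yr; rewrite ler_wsqrtr //.
have -> : d%:R * r ^+ 2 = \sum_(i < d) r ^+ 2.
  by rewrite sumr_const card_ord mulr_natl.
apply: ler_sum => i _; rewrite -expr2 -real_normK ?num_real //.
have r0 : 0 <= r by rewrite (le_trans _ yr).
by rewrite lerXn2r ?nnegrE // (le_trans _ yr) // coord_le_norm.
Qed.

End EuclideanNorm.

Lemma within_continuous_ballP (R : realType) (U : pseudoMetricType R)
    (A : set U) (g : U -> R) : {within A, continuous g} <->
  forall p, A p -> forall e : R, 0 < e -> exists2 del : R, 0 < del &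
    forall q, ball p del q -> A q -> `|g p - g q| <= e.
Proof.
split=> [/subspace_continuousP cg p Ap e e0|H].
  have /cvgrPdist_le /(_ _ e0) := cg _ Ap.
  by rewrite near_withinE => /nbhs_ballP[del /= del0 Hd]; exists del.
apply/subspace_continuousP => p Ap; apply/cvgrPdist_le => e e0.
have [del del0 Hd] := H p Ap e e0.
by rewrite near_withinE; apply/nbhs_ballP; exists del.
Qed.

(** * The time interval and local bounds on Hölder coefficients *)

Section Halfline.
Variables (R : realType) (I : set R) (hI : line_or_right_halfline I).

Lemma halfline_right_closed (c t : R) : I c -> c <= t -> I t.
Proof.
case: hI => [->//|[a [->|->]]]; rewrite /= !in_itv /= !andbT => ac ct.
  exact: lt_le_trans ct.
exact: le_trans ct.
Qed.

(** Provides one left end [c] for all starting times near [s], so that later estimates live on a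
    fixed interval. For a closed halfline its endpoint serves. *)
Lemma halfline_local_left (s : R) : I s ->
  exists2 c, I c & exists2 del : R, 0 < del &
    forall s', I s' -> `|s - s'| < del -> c <= s'.
Proof.
case: hI => [->|[a [->|->]]] /=.
- exists (s - 1) => //; exists 1 => // s' _; rewrite ltr_norml => /andP[_]; lra.
- rewrite in_itv /= andbT => sa; exists ((a + s) / 2).
    by rewrite in_itv /= andbT; lra.
  exists ((s - a) / 2); first by lra.
  by move=> s' _; rewrite ltr_norml => /andP[_]; lra.
- rewrite in_itv /= andbT => sa; exists a; first by rewrite in_itv /= lexx.
  by exists 1 => // s'; rewrite in_itv /= andbT.
Qed.

End Halfline.

(** On the compact cylinder every value is compared with the one at [(c, x0)]; [D] bounds the
    parabolic distance to that point. *)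
Lemma holder_parabolic_loc_bounded (R : realType) (d : nat) (alpha : R)
    (I : set R) (g : R * 'rV[R]_d -> R) (c T r : R) x0 :
  0 < alpha -> (forall t, c <= t -> I t) ->
  holder_parabolic_loc alpha (I `*` setT) g ->
  exists2 K : R, 0 <= K &
    forall t x, c <= t <= T -> `|x - x0| <= r -> `|g (t, x)| <= K.
Proof.
move=> alpha0 Ic hg.
pose A := `[c, T]%classic `*` [set y : 'rV[R]_d | `|y - x0| <= r].
have cA : compact A.
  by apply: compact_setX; [exact: segment_compact|exact: compact_norm_ball].
have AI : A `<=` I `*` setT.
  move=> [t x] [/= + _]; rewrite in_itv /= => /andP[ct _]; split=> //=; exact: Ic.
have [C HC] := hg _ cA AI.
pose D := Num.sqrt (d%:R * r ^+ 2) + Num.sqrt (T - c).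
exists (`|g (c, x0)| + `|C| * D `^ alpha).
  by rewrite addr_ge0 // mulr_ge0 // powR_ge0.
move=> t x /andP[ct tT] xr.
have r0 : 0 <= r by rewrite (le_trans _ xr).
have At : A (t, x) by split=> //=; rewrite in_itv /= ct.
have Ac : A (c, x0).
  by split=> /=; [rewrite in_itv /= lexx (le_trans ct)|rewrite subrr normr0].
rewrite -lerBlDl (le_trans (lerB_dist _ _)) // (le_trans (HC _ _ At Ac)) //.
rewrite (le_trans (ler_wpM2r _ (ler_norm C))) ?powR_ge0 // ler_wpM2l //.
apply: ge0_ler_powR; rewrite ?nnegrE ?addr_ge0 ?sqrtr_ge0 ?(ltW alpha0) //.
rewrite lerD ?enorm_le_norm //= ler_wsqrtr // ger0_norm ?subr_ge0 //.
by rewrite lerB.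
Qed.

(** * Comparison on the whole space by means of a Lyapunov function *)

Section Lyapunov.
Variables (R : realType) (d : nat).
Variables (Q : R -> 'rV[R]_d -> 'M[R]_d) (b : R -> 'rV[R]_d -> 'rV[R]_d).
Implicit Types (phi : 'rV[R]_d -> R) (u : R -> 'rV[R]_d -> R).

Lemma tends_to_pinfty_bounded_below phi : continuous phi -> tends_to_pinfty phi ->
  exists m : R, forall x, m <= phi x.
Proof.
move=> cphi /(_ 0) [r Hr]; pose A := [set x : 'rV[R]_d | `|x - 0| <= Num.max r 0].
have A0 : A !=set0 by exists 0; rewrite /A /= subrr normr0 le_max lexx orbT.
have [x1 _ min] := compact_EVT_min A0 (@compact_norm_ball _ _ 0 _)
  (continuous_subspaceT cphi).
exists (Num.min (phi x1) 0) => x; rewrite ge_min.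
have [/Hr ->|xr] := leP r (enorm x); first by rewrite orbT.
rewrite min // inE /A /= subr0 le_max (le_trans (norm_le_enorm x)) //.
exact: ltW.
Qed.

(** Nonnegativity is included so that adding a multiple of [phi] only raises a barrier. *)
Definition lyapunov_function (s T M : R) phi :=
  [/\ C2 phi, tends_to_pinfty phi, forall x, 0 <= phi x &
      forall t x, s <= t <= T -> generator Q b t phi x <= M].

(** Subtracting a lower bound makes [phi] nonnegative, and the generator annihilates constants. *)
Lemma lyapunov_function_shift (s T M : R) phi : C2 phi -> tends_to_pinfty phi ->
  (forall t x, s <= t <= T -> generator Q b t phi x <= M) ->
  exists psi, lyapunov_function s T M psi.
Proof.
move=> Cphi phioo gphi.
have cphi : continuous phi by case: Cphi.
have [m Hm] := tends_to_pinfty_bounded_below cphi phioo.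
exists (fun x => phi x + (- m) * 1); split.
- exact: (C2_linear (- m) Cphi (C2_cst d 1)).
- by move=> A; have [r Hr] := phioo (A + m); exists r => x /Hr; lra.
- by move=> x; have := Hm x; lra.
- move=> t x /gphi gt; rewrite (generator_linear _ _ _ (g := fun=> 1)).
  + by rewrite generator_cst mulr0 addr0.
  + by case: Cphi.
  + by case: (C2_cst d (1 : R)).
Qed.

(** Growth of [phi] against the bound [B] settles the lateral boundary of a large ball. The
    multiplier is first raised to [c + e], which is positive even when [c = 0]; the ball depends on
    [e], the resulting estimate does not, and [e] tends to 0. *)
Lemma comparison_lyapunov (s T M a c B : R) phi u :
  (forall t x, s < t <= T -> psd (Q t x)) -> solves Q b s u ->
  lyapunov_function s T M phi -> 0 <= M -> 0 <= c ->
  (forall t x, s <= t -> u t x <= B) ->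
  (forall x, u s x <= a + c * phi x) ->
  forall t x, s <= t <= T -> u t x <= a + c * (phi x + M * (t - s)).
Proof.
move=> pQ su [Cphi phioo phi0 gphi] M0 c0 uB uinit t x /andP[st tT].
pose W := phi x + M * (t - s).
have W0 : 0 <= W by rewrite addr_ge0 // mulr_ge0 // subr_ge0.
suff H e : 0 < e -> u t x <= a + (c + e) * W.
  apply/ler_addgt0Pr => e e0.
  have eW : 0 < e / (W + 1) by rewrite divr_gt0 // ltr_wpDl.
  apply: (le_trans (H _ eW)); rewrite mulrDl addrA lerD2l.
  by rewrite mulrAC ler_pdivrMr ?ltr_wpDl // ler_pM2l // lerDl.
move=> e0; have ce0 : 0 < c + e by rewrite ltr_wpDl.
have [r1 Hr1] := phioo ((B - a) / (c + e)).
(* Beyond [r1] the barrier exceeds [B]; taking [r] at least [|x|] puts the given point in the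
   ball. *)
pose r := Num.max r1 `|x|.
have -> : a + (c + e) * W = a + ((c + e) * M) * (t - s) + (c + e) * phi x.
  by rewrite /W; ring.
apply: (@comparison_on_cylinder _ _ Q b s T 0 r) => //.
- by move=> y _; rewrite (le_trans (uinit y)) // lerD2l ler_wpM2r // lerDl ltW.
- move=> t1 y /andP[st1 _]; rewrite subr0 => yr.
  have : (B - a) / (c + e) <= phi y.
    by apply: Hr1; rewrite (le_trans _ (norm_le_enorm y)) // yr le_max lexx.
  rewrite ler_pdivrMr // => Bphi; apply: (le_trans (uB _ _ (ltW st1))).
  have : 0 <= (c + e) * M * (t1 - s).
    by rewrite mulr_ge0 ?mulr_ge0 ?subr_ge0 // ltW.
  by move: Bphi; move: (_ * (t1 - s)) (phi y) => X Y; clear; lra.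
- by move=> t1 y /andP[/ltW st1 t1T] _; rewrite ler_pM2l // gphi // st1.
- by rewrite st.
- by rewrite subr0 le_max lexx orbT.
Qed.

End Lyapunov.

(** * Estimates near the initial time and their propagation, uniform in the starting time *)

Section Layers.
Variables (R : realType) (d : nat).
Variables (Q : R -> 'rV[R]_d -> 'M[R]_d) (b : R -> 'rV[R]_d -> 'rV[R]_d).
Variables (c T : R).
Hypothesis psdQ : forall t x, c <= t <= T -> psd (Q t x).
Implicit Types (phi f : 'rV[R]_d -> R) (u v : R -> 'rV[R]_d -> R).

Let psdQ_after s : c <= s -> forall t x, s < t <= T -> psd (Q t x).
Proof.
by move=> cs t x /andP[st tT]; apply: psdQ; rewrite tT (le_trans cs) // ltW.
Qed.

(* Barrier [f x0 + eps/3 + c1 |x - x0|^2 + k (t - s)] on a ball around [x0] on which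
   [f <= f x0 + eps/3]; [c1] is chosen so that it exceeds [F] on the boundary. *)
Lemma initial_layer x0 f (F eps : R) :
  (forall r : R, exists2 K : R, 0 <= K & forall t x, c <= t <= T -> `|x - x0| <= r ->
    generator Q b t (fun y => dotp (y - x0) (y - x0)) x <= K) ->
  continuous f -> 0 < eps ->
  exists2 del : R, 0 < del & forall s u, c <= s -> solves Q b s u ->
    (forall x, u s x = f x) -> (forall t x, s <= t <= T -> u t x <= F) ->
    forall t x, s <= t <= T -> t - s < del -> `|x - x0| < del ->
    u t x <= f x0 + eps.
Proof.
move=> genK cf eps0; have eps3 : 0 < eps / 3 by rewrite divr_gt0.
have /cvgrPdist_lt /(_ _ eps3) /nbhs_ballP[r' /= r'0 Hr'] := cf x0.
pose r := r' / 2; have r0 : 0 < r by rewrite divr_gt0.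
have fr x : `|x - x0| <= r -> f x <= f x0 + eps / 3.
  move=> xr; have /Hr' : ball x0 r' x.
    by rewrite -ball_normE /= distrC (le_lt_trans xr) // /r; lra.
  by rewrite ltr_norml => /andP[+ _]; lra.
have [K K0 HK] := genK r.
(* On the sphere of radius [r] for the sup norm the squared Euclidean distance is at least [r ^+ 2],
   so the quadratic term is at least [|F| + |f x0|]. *)
pose c1 := (`|F| + `|f x0|) / r ^+ 2.
have c10 : 0 <= c1 by rewrite divr_ge0 ?sqr_ge0 // addr_ge0.
pose q x := dotp (x - x0) (x - x0).
have cq : continuous (fun x => c1 * q x).
  have [_ cq _ _] := C2_sqdist x0.
  by move=> x; apply: (@continuousM _ _ (cst c1) q); [exact: cst_continuous|exact: cq].
have /cvgrPdist_lt /(_ _ eps3) /nbhs_ballP[r2 /= r20 Hr2] := cq x0.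
have q0 : q x0 = 0.
  by rewrite /q subrr /dotp big1 // => i _; rewrite mxE mul0r.
(* For [t - s < del1] the term linear in time is at most [eps / 3]; the radius [r2] does the same
   for the quadratic term. *)
pose del1 := eps / 3 / (c1 * K + 1).
have cK : 0 <= c1 * K by rewrite mulr_ge0.
have del10 : 0 < del1 by rewrite divr_gt0 // ltr_wpDl.
exists (Num.min del1 (Num.min r r2)); first by rewrite !lt_min del10 r0 r20.
move=> s u cs su us uF t x stT; rewrite !lt_min => /and3P[tdel _ _] /and3P[_ xr xr2].
have : u t x <= (f x0 + eps / 3) + (c1 * K) * (t - s) + c1 * q x.
  apply: (@comparison_on_cylinder _ _ Q b s T x0 r) => //.
  - exact: psdQ_after.
  - exact: C2_sqdist.
  - by move=> y yr; rewrite us (le_trans (fr _ yr)) // lerDl mulr_ge0 // dotp_ge0.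
  - move=> t1 y /andP[st1 t1T] yr.
    have uF1 : u t1 y <= F by apply: uF; rewrite t1T ltW.
    have : `|F| + `|f x0| <= c1 * q y.
      rewrite -[leLHS](divfK (x := r ^+ 2)) ?lt0r_neq0 ?exprn_gt0 //.
      by rewrite ler_wpM2l // -yr sqr_norm_le_dotp.
    have : 0 <= c1 * K * (t1 - s) by rewrite mulr_ge0 // subr_ge0 ltW.
    have := ler_norm F; have := ler_norm (- f x0); rewrite normrN.
    move: uF1 eps0; move: (u t1 y) (c1 * K * _) (c1 * q y) (f x0) => U1 X Y Z.
    by lra.
  - move=> t1 y /andP[st1 t1T] yr; rewrite ler_wpM2l //.
    by apply: HK; rewrite ?t1T ?(le_trans cs (ltW st1)) // ltW.
  - exact: ltW.
have : c1 * q x < eps / 3.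
  have /Hr2 : ball x0 r2 x by rewrite -ball_normE /= distrC.
  by rewrite q0 mulr0 sub0r normrN; apply: le_lt_trans; exact: ler_norm.
have : c1 * K * (t - s) <= eps / 3.
  apply: le_trans (_ : (c1 * K + 1) * del1 <= _); last first.
    by rewrite /del1 mulrC divfK // lt0r_neq0 // ltr_wpDl.
  case/andP: stT => st _.
  by rewrite ler_pM ?subr_ge0 ?lerDl // ltW.
move: (u t x) (c1 * K * _) (c1 * q x) (f x0) => U1 X Y Z.
by lra.
Qed.

(** The Lyapunov comparison with multiplier 0: the a priori bound [B] is replaced by the bound [F]
    of the datum. *)
Lemma solution_le_sup (M F B s : R) phi u : c <= s -> 0 <= M ->
  lyapunov_function Q b c T M phi -> solves Q b s u ->
  (forall t x, s <= t -> u t x <= B) -> (forall x, u s x <= F) ->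
  forall t x, s <= t <= T -> u t x <= F.
Proof.
move=> cs M0 [Cphi phioo phi0 gphi] su uB uF t x stT.
have -> : F = F + 0 * (phi x + M * (t - s)) by rewrite mul0r addr0.
apply: (comparison_lyapunov (psdQ_after cs) su _ M0 (lexx 0) uB) => //.
  by split=> // t1 x1 /andP[st1 ?]; apply: gphi; rewrite (le_trans cs).
by move=> y; rewrite mul0r addr0.
Qed.

(** The barrier [eps / 2 + c1 (phi + M (t - s))] dominates the datum: inside the ball of radius [r]
    by its constant, outside because [c1 phi >= F]. The numbers [r] and [del] are fixed before [s],
    [v] and the qualitative bound [B]. *)
Lemma lyapunov_propagation (M F eps : R) phi x0 : 0 <= M ->
  lyapunov_function Q b c T M phi -> 0 < eps ->
  exists r : R, exists2 del : R, 0 < del & forall s v B, c <= s -> solves Q b s v ->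
    (forall t x, s <= t -> v t x <= B) -> (forall x, v s x <= F) ->
    (forall x, `|x| <= r -> v s x <= eps / 2) ->
    forall t x, s <= t <= T -> `|x - x0| < del -> v t x <= eps.
Proof.
move=> M0 [Cphi phioo phi0 gphi] eps0.
have cphi : continuous phi by case: Cphi.
(* [P] bounds [phi x + M * (t - s)] for [x] near [x0], and [c1 * P = eps / 2]. *)
pose P := phi x0 + 1 + M * `|T - c|.
have MT : 0 <= M * `|T - c| by rewrite mulr_ge0.
have P0 : 0 < P by have := phi0 x0; rewrite /P; lra.
pose c1 := eps / 2 / P; have c10 : 0 < c1 by rewrite !divr_gt0.
have [r Hr] := phioo (F / c1); exists r.
have /cvgrPdist_lt /(_ _ ltr01) /nbhs_ballP[del /= del0 Hdel] := cphi x0.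
exists del => // s v B cs sv vB vF vr t x stT xdel.
have : v t x <= eps / 2 + c1 * (phi x + M * (t - s)).
  apply: (comparison_lyapunov (psdQ_after cs) sv _ M0 (ltW c10) vB) => //.
    by split=> // t1 x1 /andP[st1 ?]; apply: gphi; rewrite (le_trans cs).
  move=> y; have [/vr vy|/ltW ry] := leP `|y| r.
    by rewrite (le_trans vy) // lerDl mulr_ge0 // ltW.
  have := Hr _ (le_trans ry (norm_le_enorm y)); rewrite ler_pdivrMr // => Fy.
  have := vF y; move: Fy eps0; rewrite mulrC; move: (v s y) (c1 * _) => X Y.
  by lra.
move=> vtx; apply: (le_trans vtx); rewrite [leRHS]splitr lerD2l.
have -> : eps / 2 = c1 * P by rewrite /c1 divfK // lt0r_neq0.
rewrite ler_pM2l // /P lerD //.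
  have /Hdel : ball x0 del x by rewrite -ball_normE /= distrC.
  by rewrite ltr_norml => /andP[+ _]; move: (phi x) (phi x0) => X Y; lra.
rewrite ler_wpM2l //; case/andP: stT => st tT.
by rewrite (le_trans _ (ler_norm _)) // lerB.
Qed.

End Layers.

(** * What the assumptions on the coefficients provide *)

Lemma generator_sqdist_bounded (R : realType) (d : nat) (I : set R)
    (Q : R -> 'rV[R]_d -> 'M[R]_d) (b : R -> 'rV[R]_d -> 'rV[R]_d)
    (alpha c T r : R) x0 : 0 < alpha -> (forall t, c <= t -> I t) ->
  (forall i j : 'I_d,
     holder_parabolic_loc alpha (I `*` setT) (fun p => Q p.1 p.2 i j)) ->
  (forall i : 'I_d,
     holder_parabolic_loc alpha (I `*` setT) (fun p => b p.1 p.2 0 i)) ->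
  exists2 K : R, 0 <= K & forall t x, c <= t <= T -> `|x - x0| <= r ->
    generator Q b t (fun y => dotp (y - x0) (y - x0)) x <= K.
Proof.
move=> alpha0 Ic hQ hb.
have /boolp.choice[KQ HKQ] (ij : 'I_d * 'I_d) : exists K : R, 0 <= K /\
    forall t x, c <= t <= T -> `|x - x0| <= r -> `|Q t x ij.1 ij.2| <= K.
  have [K K0 HK] := holder_parabolic_loc_bounded T r x0 alpha0 Ic (hQ ij.1 ij.2).
  by exists K.
have /boolp.choice[Kb HKb] (i : 'I_d) : exists K : R, 0 <= K /\
    forall t x, c <= t <= T -> `|x - x0| <= r -> `|b t x 0 i| <= K.
  have [K K0 HK] := holder_parabolic_loc_bounded T r x0 alpha0 Ic (hb i).
  by exists K.
(* The Hessian of the squared distance is twice the identity, and its gradient [2 (x - x0)] is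
   bounded on the ball. *)
exists (\sum_(i < d) \sum_(j < d) KQ (i, j) * 2 + \sum_(i < d) Kb i * (2 * `|r|)).
  rewrite addr_ge0 ?sumr_ge0 // => i _.
    by rewrite sumr_ge0 // => j _; rewrite mulr_ge0 //; case: (HKQ (i, j)).
  by rewrite !mulr_ge0 //; case: (HKb i).
move=> t x tT xr; rewrite /generator; apply: lerD; apply: ler_sum => i _.
  apply: ler_sum => j _; rewrite pderive2_sqdist (le_trans (ler_norm _)) //.
  rewrite normrM ler_pM //; first by case: (HKQ (i, j)) => _; apply.
  by case: (j == i); rewrite ger0_norm ?mulr1 ?mulr0.
rewrite pderive_sqdist (le_trans (ler_norm _)) // normrM ler_pM //.
  by case: (HKb i) => _; apply.
rewrite normrM ger0_norm // ler_pM2l // (le_trans (coord_le_norm _ _)) //.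
by rewrite (le_trans xr) // ler_norm.
Qed.

Lemma uniformly_elliptic_psd (R : realType) (d : nat) (I : set R)
    (Q : R -> 'rV[R]_d -> 'M[R]_d) :
  (forall t x, I t -> (Q t x)^T = Q t x) -> uniformly_elliptic Q I ->
  forall t x, I t -> psd (Q t x).
Proof.
move=> Qsym [eta [eta0 Qell]] t x It; split; first exact: Qsym.
move=> xi; have -> : (xi *m Q t x *m xi^T) 0 0 = dotp (xi *m (Q t x)^T) xi.
  by rewrite Qsym // mxE; apply: eq_bigr => i _; rewrite [xi^T _ _]mxE.
apply: le_trans (Qell t x It xi); rewrite mulr_ge0 ?sqr_ge0 //.
apply: (le_trans (ltW eta0)); apply: ge_inf; last by exists (t, x).
(* If the set had no infimum, [inf] would be 0 by convention, against [eta0]. *)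
by have [_ ?] : has_inf [set eta p.1 p.2 | p in I `*` [set: 'rV[R]_d]]
  by apply: contrapT => /inf_out E; rewrite E ltxx in eta0.
Qed.

(** * Dependence on the starting time, with [U s t x] in the role of G(t,s)f(x) *)

Section EvolutionContinuity.
Variables (R : realType) (d : nat).
Variables (Q : R -> 'rV[R]_d -> 'M[R]_d) (b : R -> 'rV[R]_d -> 'rV[R]_d).
Variables (c T M F : R) (f phi : 'rV[R]_d -> R) (U : R -> R -> 'rV[R]_d -> R).
Hypotheses (psdQ : forall t x, c <= t <= T -> psd (Q t x)) (M0 : 0 <= M).
Hypothesis lyap : lyapunov_function Q b c T M phi.
Hypothesis genK : forall (x0 : 'rV[R]_d) (r : R), exists2 K : R, 0 <= K &
  forall t x, c <= t <= T -> `|x - x0| <= r ->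
    generator Q b t (fun y => dotp (y - x0) (y - x0)) x <= K.
Hypotheses (cf : continuous f) (fF : forall x, `|f x| <= F).
Hypothesis solU : forall s, c <= s ->
  [/\ solves Q b s (U s), forall x, U s s x = f x &
      exists B : R, forall t x, s <= t -> `|U s t x| <= B].

Let solNU s : c <= s -> solves Q b s (fun t x => 0 - U s t x).
Proof. by move=> /solU[sU _ _]; apply: solves_sub => //; exact: solves0. Qed.

(** The maximum principle is applied to the solution and to its negative, written [0 - U] to be a
    difference of solutions. *)
Lemma evolution_bounded s t x : c <= s -> s <= t <= T -> `|U s t x| <= F.
Proof.
move=> cs stT; have [sU Us [B HB]] := solU cs; rewrite ler_norml; apply/andP; split.
  rewrite lerNl -sub0r.
  apply: (solution_le_sup (B := B) psdQ cs M0 lyap (solNU cs)) => // [t1 y st|y].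
    by rewrite sub0r (le_trans _ (HB t1 y st)) // -normrN ler_norm.
  by rewrite Us sub0r (le_trans _ (fF y)) // -normrN ler_norm.
apply: (solution_le_sup (B := B) psdQ cs M0 lyap sU) => // [t1 y st|y].
  by rewrite (le_trans _ (HB t1 y st)) // ler_norm.
by rewrite Us (le_trans _ (fF y)) // ler_norm.
Qed.

Lemma evolution_initial_layer x0 (eps : R) : 0 < eps ->
  exists2 del : R, 0 < del & forall s t x, c <= s -> s <= t <= T ->
    t - s < del -> `|x - x0| < del -> `|U s t x - f x0| <= eps.
Proof.
move=> eps0.
have [d1 d10 H1] := initial_layer psdQ F (genK x0) cf eps0.
have cNf : continuous (fun x => 0 - f x).
  by move=> x; apply: (@continuousB _ _ _ (cst 0) f); [exact: cst_continuous|exact: cf].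
have [d2 d20 H2] := initial_layer psdQ F (genK x0) cNf eps0.
exists (Num.min d1 d2); first by rewrite lt_min d10.
move=> s t x cs stT; rewrite !lt_min => /andP[t1 t2] /andP[x1 x2].
have [sU Us _] := solU cs.
have Ule t' x' : s <= t' <= T -> `|U s t' x'| <= F by exact: evolution_bounded.
have L1 : U s t x <= f x0 + eps.
  by apply: (H1 s (U s)) => // t' x' /(Ule _ x'); apply: le_trans; exact: ler_norm.
have L2 : 0 - U s t x <= 0 - f x0 + eps.
  apply: (H2 s (fun t x => 0 - U s t x)) => // [|y|t' x' /(Ule _ x')].
  - exact: solNU.
  - by rewrite Us.
  - by apply: le_trans; rewrite sub0r -normrN; exact: ler_norm.
by rewrite ler_distl; apply/andP; split; lra.
Qed.

(* Compactness makes [evolution_initial_layer] uniform in [x] on bounded sets. *)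
Lemma evolution_uniform_layer (r eps : R) : 0 < eps ->
  exists2 del : R, 0 < del & forall s t x, c <= s -> s <= t <= T ->
    t - s < del -> `|x| <= r -> `|U s t x - f x| <= eps.
Proof.
move=> eps0; have eps2 : 0 < eps / 2 by rewrite divr_gt0.
pose P (del : R) x := forall s t, c <= s -> s <= t <= T -> t - s < del ->
  `|U s t x - f x| <= eps.
(* The covering form of compactness is used with the filter of small positive [del]: near each
   centre one threshold serves a whole neighbourhood. *)
have /compact_near_coveringP /(_ _ (0 : R)^'+ P _) := @compact_norm_ball R d 0 r.
case=> [x0 _|del /= del0 Hdel].
  have [d1 d10 H1] := evolution_initial_layer x0 eps2.
  have /cvgrPdist_le /(_ _ eps2) /nbhs_ballP[d2 /= d20 H2] := @cf x0.
  exists (ball x0 (Num.min d1 d2), [set del : R | del < d1]); first split.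
  - by apply: nbhsx_ballx; rewrite lt_min d10.
  - exact: nbhs_right_lt.
  - move=> [x del] [/= xb deld] s t cs stT tdel.
    have [xd1 xd2] : `|x - x0| < d1 /\ ball x0 d2 x.
      move: xb; rewrite -!ball_normE /= lt_min [`|x - x0|]distrC.
      by move=> /andP.
    have := H1 s t x cs stT (lt_trans tdel deld) xd1; have := H2 _ xd2.
    move=> /= A B; rewrite -(subrKA (f x0)) (le_trans (ler_normD _ _)) //.
    by rewrite [leRHS]splitr lerD.
have D2 : 0 < del / 2 by rewrite divr_gt0.
(* The covering yields the estimate for every positive threshold below [del], hence the half. *)
exists (del / 2) => // s t x cs stT tdel xr.
apply: (Hdel (del / 2)) => //=; last by rewrite subr0.
by rewrite /= sub0r normrN gtr0_norm //; lra.
Qed.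

(* [U s1 - U s2] solves the equation after [s2], from the datum [U s1 s2 - f], which is
   small on bounded sets. *)
Lemma evolution_start_continuous x0 (eps : R) : 0 < eps ->
  exists2 del : R, 0 < del & forall s1 s2 t x, c <= s1 -> s1 <= s2 -> s2 <= t <= T ->
    s2 - s1 < del -> `|x - x0| < del -> `|U s1 t x - U s2 t x| <= eps.
Proof.
move=> eps0; have eps2 : 0 < eps / 2 by rewrite divr_gt0.
have [r [d1 d10 H1]] := lyapunov_propagation psdQ (F + F) x0 M0 lyap eps0.
have [d2 d20 H2] := evolution_uniform_layer r eps2.
exists (Num.min d1 d2); first by rewrite lt_min d10.
move=> s1 s2 t x cs1 s12 s2tT; rewrite !lt_min => /andP[_ sd] /andP[xd _].
have cs2 : c <= s2 by exact: le_trans s12.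
have s2T : s1 <= s2 <= T by rewrite s12; case/andP: s2tT => a ?; rewrite (le_trans a).
have [S1 U1 [B1 HB1]] := solU cs1; have [S2 U2 [B2 HB2]] := solU cs2.
have {}S1 := solves_restrict s12 S1.
have dB t' y : s2 <= t' -> `|U s1 t' y - U s2 t' y| <= B1 + B2.
  move=> st; rewrite (le_trans (ler_normB _ _)) // lerD ?HB1 ?HB2 //.
  exact: le_trans st.
have dF y : `|U s1 s2 y - U s2 s2 y| <= F + F.
  rewrite (le_trans (ler_normB _ _)) // lerD ?U2 ?fF //.
  exact: evolution_bounded.
have dr y : `|y| <= r -> `|U s1 s2 y - U s2 s2 y| <= eps / 2.
  by move=> yr; rewrite U2; exact: H2.
(* The propagation estimate is one-sided, so it is applied to both differences. *)
rewrite ler_norml; apply/andP; split.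
  rewrite lerNl opprB.
  apply: (H1 s2 (fun t x => U s2 t x - U s1 t x) (B1 + B2)) => //.
  - exact: solves_sub.
  - by move=> t' y /(dB t' y); apply: le_trans; rewrite distrC ler_norm.
  - by move=> y; apply: le_trans (dF y); rewrite distrC ler_norm.
  - by move=> y /dr; apply: le_trans; rewrite distrC ler_norm.
apply: (H1 s2 (fun t x => U s1 t x - U s2 t x) (B1 + B2)) => //.
- exact: solves_sub.
- by move=> t' y /(dB t' y); apply: le_trans; rewrite ler_norm.
- by move=> y; apply: le_trans (dF y); rewrite ler_norm.
- by move=> y /dr; apply: le_trans; rewrite ler_norm.
Qed.

End EvolutionContinuity.

(** * Joint continuity, on the diagonal t = s and away from it *)

Theorem theorem3p7 (R : realType) (d : nat) (hd : (1 <= d)%N)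
    (I : set R) (hI : line_or_right_halfline I)
    (Q : R -> 'rV[R]_d -> 'M[R]_d) (b : R -> 'rV[R]_d -> 'rV[R]_d)
    (alpha : R) (halpha : 0 < alpha < 1)
    (hQ : forall i j : 'I_d,
      holder_parabolic_loc alpha (I `*` setT) (fun p => Q p.1 p.2 i j))
    (hb : forall i : 'I_d,
      holder_parabolic_loc alpha (I `*` setT) (fun p => b p.1 p.2 0 i))
    (Qsym : forall t x, I t -> (Q t x)^T = Q t x)
    (Qell : uniformly_elliptic Q I)
    (lyapunov : forall J : set R, is_interval J -> bounded_set J -> J `<=` I ->
      exists phi : 'rV[R]_d -> R,
        [/\ C2 phi, tends_to_pinfty phi &
            exists M : R, 0 < M /\
              forall t x, J t -> generator Q b t phi x <= M])
    (G : R -> R -> ('rV[R]_d -> R) -> 'rV[R]_d -> R)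
    (hG : evolution_family Q b I G)
    (f : 'rV[R]_d -> R) (hf : Cb f) :
  {within Lambda I `*` [set: 'rV[R]_d],
    continuous (fun p : R * R * 'rV[R]_d => G p.1.1 p.1.2 f p.2)}.
Proof.
apply/within_continuous_ballP => -[[t0 s0] x0] /= [[/= It0 Is0 st0] _] eps eps0.
have eps2 : 0 < eps / 2 by rewrite divr_gt0.
have [alpha0 _] := andP halpha.
have [c Ic [dc dc0 Hc]] := halfline_local_left hI Is0.
have Iright t : c <= t -> I t by exact: halfline_right_closed.
(* All neighbourhoods below have radius at most 1, which keeps [t <= T]. *)
pose T := t0 + 1.
have psdQ t x : c <= t <= T -> psd (Q t x).
  move=> /andP[ct _]; exact: uniformly_elliptic_psd Qell _ _ (Iright _ ct).
have [phi0 [Cphi phioo [M [M0 gphi]]]] : exists phi : 'rV[R]_d -> R,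
    [/\ C2 phi, tends_to_pinfty phi & exists M : R, 0 < M /\
      forall t x, c <= t <= T -> generator Q b t phi x <= M].
  have [||t /=|phi [Cphi phioo [M [M0 HM]]]] := lyapunov `[c, T]%classic.
  - exact: interval_is_interval.
  - exact/compact_bounded/segment_compact.
  - by rewrite in_itv /= => /andP[/Iright].
  - by exists phi; split=> //; exists M.
have [phi lyap] := lyapunov_function_shift Cphi phioo gphi.
have genK x1 r := generator_sqdist_bounded T r x1 alpha0 Iright hQ hb.
have [cf [Mf [_ Hf]]] := hf.
(* Boundedness in the library gives a bound for every number strictly above [Mf]. *)
pose F := Mf + 1.
have fF x : `|f x| <= F by apply: Hf => //; rewrite ltrDl.
have solG s : c <= s -> [/\ solves Q b s (fun t => G t s f),
    forall x, G s s f x = f x &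
    exists B : R, forall t x, s <= t -> `|G t s f x| <= B].
  move=> /Iright Is; have sol := hG _ _ Is hf; split.
  - exact: bounded_classical_solution_solves sol.
  - by case: sol.
  - case: sol => _ [B [_ HB]] _ _ _; exists (B + 1) => t x st.
    by apply: (HB (B + 1) _ (t, x)); [rewrite ltrDl|split=> //=; rewrite in_itv /= st].
have cs0 : c <= s0 by apply: Hc => //; rewrite subrr normr0.
have [[cG _ _] Gs0 _] := solG _ cs0.
(* On the diagonal the value is [f x0] and the initial layer suffices; moving [t] and [s] by less
   than [del / 2] each keeps [t - s < del]. *)
have [ts|ts] := eqVneq t0 s0.
  have [del del0 Hdel] := evolution_initial_layer (U := fun s t => G t s f) psdQ
    (ltW M0) lyap genK cf fF solG x0 eps0.
  exists (Num.min (Num.min dc (del / 2)) 1).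
    by rewrite !lt_min dc0 ltr01 andbT /=; lra.
  move=> [[t s] x] [[/=]]; rewrite -!ball_normE /= !lt_min ts.
  move=> /andP[/andP[_ td] t1] /andP[/andP[sd sd2] _] /andP[/andP[_ xd] _].
  move=> [[/= It Is st] _].
  rewrite Gs0 distrC; apply: Hdel.
  - exact: Hc.
  - by rewrite st /T ts; move: t1; rewrite ltr_norml => /andP[+ _]; lra.
  - move: td sd2; rewrite !ltr_norml => /andP[+ _] /andP[_ +]; lra.
  - by rewrite distrC (lt_trans xd) //; lra.
have {ts}st0' : s0 < t0 by rewrite lt_def ts.
have At0 : (`[s0, +oo[%classic `*` [set: 'rV[R]_d]) (t0, x0).
  by split=> //=; rewrite in_itv /= st0.
have /within_continuous_ballP /(_ _ At0 _ eps2)[d1 d10 H1] := cG.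
have [d2 d20 H2] := evolution_start_continuous (U := fun s t => G t s f) psdQ
  (ltW M0) lyap genK cf fF solG x0 eps2.
(* The radius [(t0 - s0) / 2] keeps [t] above [s0], so the intermediate value [G t s0 f x] lies on
   the solution started at [s0]; [dc] keeps [s] to the right of [c]. *)
exists (Num.min (Num.min (Num.min dc d1) (Num.min d2 ((t0 - s0) / 2))) 1).
  by rewrite !lt_min dc0 d10 d20 ltr01 andbT /=; lra.
move=> [[t s] x] [[/=]]; rewrite -!ball_normE /= !lt_min.
move=> /andP[/andP[/andP[_ td1] /andP[_ td]] t1].
move=> /andP[/andP[/andP[sdc _] /andP[sd2 sd]] _].
move=> /andP[/andP[/andP[_ xd1] /andP[xd2 _]] _] [[/= It Is st] _].
move: (td) (sd) (sd2) t1; rewrite !ltr_norml.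
move=> /andP[ta tb] /andP[sa sb] /andP[s2a s2b] /andP[t1a t1b].
have tT : t <= T by rewrite /T; lra.
have A : `|G t0 s0 f x0 - G t s0 f x| <= eps / 2.
  apply: (H1 (t, x)); first by split; rewrite /= -ball_normE.
  by split=> //=; rewrite in_itv /= andbT; lra.
have B : `|G t s0 f x - G t s f x| <= eps / 2.
  (* Continuity in the starting time is stated for ordered starting times, so [s] may be the later
     or the earlier one. *)
  have [s0s|/ltW ss0] := leP s0 s.
    by apply: H2 => //; rewrite ?st // 1?distrC //; lra.
  rewrite distrC; apply: H2 => //; rewrite 1?distrC //; first exact: Hc.
    by rewrite tT andbT; lra.
by rewrite -(subrKA (G t s0 f x)) (le_trans (ler_normD _ _)) // [leRHS]splitr lerD.
Qed.
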